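(* For one-sided matching with $n$ agents and $n$ items: (i) for any constant $k\ge1$, every deterministic algorithm making at most $k$ value queries per agent has distortion $\Omega(n^{1/k})$ when valuations are unrestricted, and $\Omega(n^{1/(k+1)})$ when valuations are unit-sum; (ii) every deterministic algorithm making at most $o\!\left(\frac{\log n}{\log\log n}\right)$ value queries per agent has distortion $\omega(\log\log n)$. This holds both for unrestricted and for unit-sum valuations.
   Context: One-sided matching: there is a set $N$ of $n$ agents and a set $A$ of $n$ items. Each agent $i$ has a valuation function $v_i:A\to\mathbb{R}_{\ge0}$. Valuations are unrestricted if arbitrary, and unit-sum if $\sum_j v_i(j)=1$ for every $i$. A deterministic algorithm receives the agents' strict rankings consistent with their values, adaptively makes value queries $(i,j)\mapsto v_i(j)$ (a bounded number per agent), and outputs a bijection $Y:N\to A$. Its distortion is the worst case over valuation profiles in the class of $\max_Z\sum_i v_i(z_i)/\sum_i v_i(y_i)$. *)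

(* Defs.v *)
From HB Require Import structures.
From mathcomp Require Import all_boot all_order all_algebra all_fingroup.
From mathcomp Require Import all_classical all_reals all_analysis.
Set Implicit Arguments. Unset Strict Implicit. Unset Printing Implicit Defensive.
Import Order.TTheory GRing.Theory Num.Theory.
Local Open Scope ring_scope.

Section Matching.
Variables (R : realType) (n : nat).

(* valuation profile: v i j = value of agent i for item j *)
Definition profile := 'I_n -> 'I_n -> R.

(* a ranking profile: (rk i) r = the item that agent i ranks at position r
   (position 0 = most preferred) *)
Definition rankings := 'I_n -> {perm 'I_n}.

Definition consistent (v : profile) (rk : rankings) : Prop :=
  forall (i r r' : 'I_n), (r <= r')%N -> v i (rk i r') <= v i (rk i r).

Definition unrestricted (v : profile) : Prop := forall i j, 0 <= v i j.
Definition unit_sum (v : profile) : Prop :=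
  unrestricted v /\ forall i, \sum_(j < n) v i j = 1.

(* a history of value queries: ((agent, item), answer) *)
Definition history := seq ('I_n * 'I_n * R).

(* A deterministic adaptive algorithm: given the rankings and the history of
   answers so far, it either asks a next query (Some (i,j)) or stops (None);
   its output bijection agents -> items is a function of rankings + history. *)
Record algorithm := Algorithm {
  alg_next : rankings -> history -> option ('I_n * 'I_n);
  alg_output : rankings -> history -> {perm 'I_n} }.

Fixpoint run (A : algorithm) (rk : rankings) (v : profile) (fuel : nat) : history :=
  match fuel with
  | 0 => [::]
  | f.+1 => let h := run A rk v f in
            match alg_next A rk h with
            | Some (i, j) => rcons h (i, j, v i j)
            | None => h
            end
  end.

Definition queries_to (h : history) (i : 'I_n) : nat :=
  count (fun q : 'I_n * 'I_n * R => q.1.1 == i) h.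

(* A makes at most k value queries per agent on every input from class [cls]
   (it then makes at most n*k queries in total, so it has stopped after n*k steps) *)
Definition at_most_queries (A : algorithm) (k : nat) (cls : profile -> Prop) : Prop :=
  forall v rk, cls v -> consistent v rk ->
    alg_next A rk (run A rk v (n * k)) = None /\
    forall i, (queries_to (run A rk v (n * k)) i <= k)%N.

Definition alg_matching (A : algorithm) (k : nat) (v : profile) (rk : rankings)
  : {perm 'I_n} := alg_output A rk (run A rk v (n * k)).

Definition social_welfare (v : profile) (Y : {perm 'I_n}) : R :=
  \sum_(i < n) v i (Y i).

Definition opt_welfare (v : profile) : R :=
  \big[Num.max/0]_(Z : {perm 'I_n}) social_welfare v Z.

(* "the distortion of A (with query budget k) over class cls is at least d":
   some input of the class has  max_Z sw(Z) / sw(Y) >= d  (ratio taken as +oo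
   when sw(Y) = 0 < max_Z sw(Z)). *)
Definition distortion_at_least (A : algorithm) (k : nat) (cls : profile -> Prop)
  (d : R) : Prop :=
  exists v rk, cls v /\ consistent v rk /\ 0 < opt_welfare v /\
    d * social_welfare v (alg_matching A k v rk) <= opt_welfare v.

End Matching.

(* Main.v *)
Require Import Defs.
From HB Require Import structures.
From mathcomp Require Import all_boot all_order all_algebra all_fingroup.
From mathcomp Require Import all_classical all_reals all_analysis.
From mathcomp Require Import zify ring lra.
Set Implicit Arguments. Unset Strict Implicit. Unset Printing Implicit Defensive.
Import Order.TTheory GRing.Theory Num.Theory.
Local Open Scope ring_scope.

(** All agents share one ranking.  With [m ^ K <= n], cut the positions into
    K + 1 blocks, block [t] being [m^(t-1) <= r < m^t] (block 0 is position 0,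
    block K is everything from [m^(K-1)] on), and answer every query in block
    [t < K] by [m^-t] and every query in block K by 0.  At these values every
    block is worth at most 1, so no matching collects more than K.

    Unrestricted, K queries: every agent has an unqueried block, and some block
    [t] is unqueried for a fraction 1/(K+1) of the agents.  Raise it to the level
    [m^(1-t)] of the preceding block for those of them that the algorithm did
    not serve in it; the algorithm does not notice, while the optimum becomes of
    order [m / K].  The last block is too large for this: there an agent is
    raised only above the position it received, and the optimum is compared with
    the algorithm's own matching shifted by one position.

    Unit-sum, K - 1 queries: scale the answers by [4 / m].  Every agent has two
    unqueried blocks, hence one that does not contain the item it is given; put
    its missing mass there, uniformly.  The algorithm collects at most
    [4 K / m], while the optimum is at least [1 / (2 (K + 1))].

    Both give distortion at least [m / (8 K (K + 1))]: take [m] to be the floor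
    of [n^(1/K)] for (i) and of [(ln n)^4] for (ii). *)

(** * Runs of an algorithm on profiles it cannot tell apart *)

Section Run.
Variables (R : realType) (n : nat) (A : algorithm R n) (rk : rankings n).

Lemma runS_sub (v : profile R n) f :
  {subset run A rk v f <= run A rk v f.+1}.
Proof.
move=> q qh /=; case: (alg_next _ _ _) => [[i j]|//].
by rewrite mem_rcons inE qh orbT.
Qed.

(** The next query depends only on the answers so far, so the two runs cannot diverge before a query
    whose answers differ. Agreement on the queries of one run suffices. *)
Lemma eq_run (v w : profile R n) f :
    {in run A rk w f, forall q, v q.1.1 q.1.2 = w q.1.1 q.1.2} ->
  run A rk v f = run A rk w f.
Proof.
elim: f => [//|f IHf] vw.
have /= -> := IHf (fun q qh => vw q (runS_sub qh)).
move: vw => /=; case: (alg_next _ _ _) => [[i j]|//] vw.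
by have := vw (i, j, w i j); rewrite mem_rcons inE eqxx /= => ->.
Qed.

Lemma queries_to_run_le (v : profile R n) f g i : (f <= g)%N ->
  (queries_to (run A rk v f) i <= queries_to (run A rk v g) i)%N.
Proof.
move=> /subnKC <-; elim: (g - f)%N => [|d IHd]; first by rewrite addn0.
rewrite addnS /=; case: (alg_next _ _ _) => [[a b]|//].
by rewrite /queries_to -cats1 count_cat (leq_trans IHd) ?leq_addr.
Qed.

Lemma queries_to_runS (v : profile R n) f i :
  (queries_to (run A rk v f.+1) i <= (queries_to (run A rk v f) i).+1)%N.
Proof.
rewrite /=; case: (alg_next _ _ _) => [[a b]|//].
by rewrite /queries_to -cats1 count_cat /= addn0; case: (a == i); lia.
Qed.

End Run.

(** * Partial matchings and the pigeonhole principle *)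

Lemma partial_perm (T : finType) (S B : {set T}) c :
    (c <= #|S|)%N -> (c <= #|B|)%N ->
  exists (Z : {perm T}) (D : {set T}),
    [/\ D \subset S, #|D| = c & {in D, forall i, Z i \in B}].
Proof.
elim: c => [_ _|c IHc cS cB].
  by exists 1%g, finset.set0; rewrite finset.sub0set cards0; split=> // i; rewrite inE.
have [Z [D [DS Dc ZD]]] := IHc (ltnW cS) (ltnW cB).
have [i iS iD] : exists2 i, i \in S & i \notin D.
  have /card_gt0P[i] : (0 < #|S :\: D|)%N.
    by rewrite cardsD (finset.setIidPr DS) Dc subn_gt0.
  by rewrite inE => /andP[iD iS]; exists i.
have ZDB : [set Z d | d in D] \subset B.
  by apply/fintype.subsetP => _ /imsetP[d dD ->]; exact: ZD.
have [j jB jD] : exists2 j, j \in B & j \notin [set Z d | d in D].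
  have /card_gt0P[j] : (0 < #|B :\: [set Z d | d in D]|)%N.
    by rewrite cardsD (finset.setIidPr ZDB) card_imset ?Dc ?subn_gt0 //; exact: perm_inj.
  by rewrite inE => /andP[jD jB]; exists j.
(* Both [Z i] and [j] lie outside the image of [D], so the transposition redirects [i] to [j]
   without moving the agents already placed. *)
exists (Z * tperm (Z i) j)%g, (i |: D)%SET.
split; first by rewrite finset.subUset finset.sub1set iS.
  by rewrite cardsU1 iD Dc.
move=> d; rewrite in_setU1 permM => /orP[/eqP ->|dD]; first by rewrite tpermL.
rewrite tpermD ?ZD //.
  by apply: contraNneq iD => /perm_inj ->.
by apply: contraNneq jD => ->; exact: imset_f.
Qed.

Lemma pigeonhole_fiber (T T' : finType) (f : T -> T') : (0 < #|T|)%N ->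
  exists y, (#|T| <= #|T'| * #|[set x | f x == y]|)%N.
Proof.
move=> /card_gt0P[x0 _].
have [y ymax] := @bigop.eq_bigmax T' (fun y => #|[set x | f x == y]|)
  (ltac:(by apply/card_gt0P; exists (f x0))).
exists y; rewrite -ymax -[in leqLHS]sum1_card.
rewrite (partition_big f predT) //= -sum_nat_const; apply: leq_sum => z _.
rewrite sum1_card; apply: leq_trans (bigop.leq_bigmax z).
by rewrite cardsE.
Qed.

(** * Bounds on welfare and distortion *)

Section Welfare.
Variables (R : realType) (n : nat) (v : profile R n).

Lemma social_welfare_le_opt (Z : {perm 'I_n}) :
  social_welfare v Z <= opt_welfare v.
Proof. exact: le_bigmax. Qed.

Hypothesis v_ge0 : unrestricted v.

Lemma social_welfare_ge0 (Z : {perm 'I_n}) : 0 <= social_welfare v Z.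
Proof. by apply: sumr_ge0 => i _. Qed.

Lemma social_welfare_ge (Z : {perm 'I_n}) (D : {set 'I_n}) (x : R) :
  {in D, forall i, x <= v i (Z i)} -> #|D|%:R * x <= social_welfare v Z.
Proof.
move=> xD; rewrite mulr_natl -sumr_const /social_welfare.
rewrite [leRHS](bigID (mem D)) /=.
by apply: ler_wpDr; [exact: sumr_ge0 | exact: ler_sum].
Qed.

Lemma opt_welfare_ge (S B : {set 'I_n}) c (x : R) :
    (c <= #|S|)%N -> (c <= #|B|)%N ->
    {in S & B, forall i j, x <= v i j} ->
  c%:R * x <= opt_welfare v.
Proof.
move=> cS cB xv; have [Z [D [/fintype.subsetP DS <- ZD]]] := partial_perm cS cB.
apply: le_trans (social_welfare_le_opt Z).
by apply: social_welfare_ge => i iD; apply: xv; [exact: DS | exact: ZD].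
Qed.

End Welfare.

(** Reduces both constructions to an upper bound [a] on the algorithm and a lower bound [w] on the
    optimum. The sign condition is on [d'], so [d] may be any real below it. *)
Lemma distortion_at_least_ratio (R : realType) n (A : algorithm R n) k
    (cls : profile R n -> Prop) v rk (d d' a w : R) :
    cls v -> consistent v rk -> unrestricted v ->
    social_welfare v (alg_matching A k v rk) <= a -> 0 < w ->
    w <= opt_welfare v -> 0 <= d' -> d' * a <= w -> d <= d' ->
  distortion_at_least A k cls d.
Proof.
move=> clsv vrk v0 sa w0 wo d'0 d'aw dd'.
exists v, rk; split=> //; split=> //; split; first exact: lt_le_trans wo.
apply: le_trans wo; apply: le_trans d'aw.
apply: (@le_trans _ _ (d' * social_welfare v (alg_matching A k v rk))).
  by rewrite ler_wpM2r// social_welfare_ge0.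
by rewrite ler_wpM2l.
Qed.

(** * Blocks of positions and their levels *)

(** [up_log m r.+1] is the least t with r < m^t; the cap at K gathers all remaining positions in the
    last block. *)
Definition bucket (m K r : nat) : 'I_K.+1 := inord (minn (up_log m r.+1) K).

Definition block (n m K : nat) (t : 'I_K.+1) : {set 'I_n} :=
  [set r : 'I_n | bucket m K r == t].

Definition level (R : realType) (m K t : nat) : R :=
  if (t < K)%N then m%:R ^- t else 0.

Lemma card_ord_lt n a : (a <= n)%N -> #|[set r : 'I_n | (r < a)%N]| = a.
Proof.
move=> an; rewrite -sum1_card; under eq_bigl do rewrite inE.
by rewrite (big_ord_narrow an) sum1_card card_ord.
Qed.

Section Levels.
Variables (R : realType) (m K : nat).
Hypothesis m_gt1 : (1 < m)%N.

Let m_gt0 : 0 < m%:R :> R. Proof. by rewrite ltr0n ltnW. Qed.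

Lemma bucketE r : bucket m K r = minn (up_log m r.+1) K :> nat.
Proof. by rewrite inordK // ltnS geq_minr. Qed.

Lemma bucket_leq r t : (t < K)%N -> (bucket m K r <= t)%N = (r < m ^ t)%N.
Proof.
move=> tK; rewrite bucketE geq_min [(K <= t)%N]leqNgt tK orbF.
apply/idP/idP => [ut|]; last exact: up_log_min.
by apply: leq_trans (up_logP _ m_gt1) _; rewrite leq_pexp2l // ltnW.
Qed.

Lemma bucket_homo r r' : (r <= r')%N -> (bucket m K r <= bucket m K r')%N.
Proof.
move=> rr'; rewrite !bucketE leq_min geq_minr andbT.
by rewrite (leq_trans (geq_minl _ _)) // leq_up_log.
Qed.

Lemma level_ge0 t : 0 <= level R m K t.
Proof. by rewrite /level; case: ifP => // _; rewrite invr_ge0 exprn_ge0 // ltW. Qed.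

Lemma level_le t : level R m K t <= m%:R ^- t.
Proof. by rewrite /level; case: ifP => // _; rewrite invr_ge0 exprn_ge0 // ltW. Qed.

(** The left side is m^(1-t), and s is at most t-1. Writing m^-t instead of [level] covers t = K,
    where [level] vanishes, so that the last block can be raised too. *)
Lemma level_gap s t : (s < t)%N -> (t <= K)%N ->
  m%:R * m%:R ^- t <= level R m K s.
Proof.
move=> st tK; rewrite /level (leq_trans st tK).
rewrite ler_pdivrMr ?exprn_gt0 // mulrC ler_pdivlMr ?exprn_gt0 // -exprS.
by rewrite ler_weXn2l // ler1n ltnW.
Qed.

Lemma level_homo s t : (s <= t)%N -> level R m K t <= level R m K s.
Proof.
rewrite leq_eqVlt => /orP[/eqP -> //|st].
have [tK|Kt] := ltnP t K; last by rewrite {1}/level ltnNge Kt level_ge0.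
apply: le_trans (level_gap st (ltnW tK)); apply: (le_trans (level_le t)).
by rewrite ler_peMl ?ler1n ?invr_ge0 ?exprn_ge0 ?ler0n // ltnW.
Qed.

End Levels.

Section Blocks.
Variables (R : realType) (n m K : nat).
Hypotheses (K_gt0 : (0 < K)%N) (m_gt1 : (1 < m)%N) (mKn : (m ^ K <= n)%N).

Lemma expn_le t : (t <= K)%N -> (m ^ t <= n)%N.
Proof. by move=> tK; rewrite (leq_trans _ mKn) // leq_pexp2l // ltnW. Qed.

Lemma card_block_le (t : 'I_K.+1) : (t < K)%N -> (#|block n m t| <= m ^ t)%N.
Proof.
move=> tK; rewrite -[leqRHS](card_ord_lt (expn_le (ltnW tK))).
apply/subset_leq_card/fintype.subsetP => r; rewrite !inE => /eqP rt.
by rewrite -(@bucket_leq m K) // rt.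
Qed.

(** For t > 0, the first m^t positions lie in the first m^(t-1) or in block t, and the former are at
    most half of them since m is at least 2. *)
Lemma card_block_ge (t : 'I_K.+1) : (m ^ t <= 2 * #|block n m t|)%N.
Proof.
have tK : (t <= K)%N by rewrite -ltnS.
have [t0|t_gt0] := posnP t.
  rewrite t0 expn0 muln_gt0 /=; apply/card_gt0P.
  have n0 : (0 < n)%N by apply: leq_trans (expn_le (leq0n _)); rewrite expn0.
  exists (Ordinal n0); rewrite inE; apply/eqP/val_inj/eqP => /=.
  by rewrite t0 -leqn0 bucket_leq // expn0.
have tS : t.-1.+1 = t by rewrite prednK.
have sub : [set r : 'I_n | (r < m ^ t)%N] \subset
    [set r : 'I_n | (r < m ^ t.-1)%N] :|: block n m t.
  apply/fintype.subsetP => r; rewrite !inE => rt.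
  case: ltnP => //= rt1; apply/eqP/val_inj/eqP => /=.
  have tb : ~~ (bucket m K r <= t.-1)%N by rewrite bucket_leq ?tS // -leqNgt.
  have bt : (bucket m K r <= t)%N.
    move: tK; rewrite leq_eqVlt => /orP[/eqP ->|tK]; first by rewrite -ltnS.
    by rewrite bucket_leq.
  by clear -tb bt t_gt0; lia.
have := leq_trans (subset_leq_card sub) (leq_card_setU _ _).
rewrite !card_ord_lt ?expn_le //; last by rewrite (leq_trans (leq_pred _)).
have : (2 * m ^ t.-1 <= m ^ t)%N.
  by rewrite -{2}tS expnS leq_mul2r m_gt1 orbT.
by move: (m ^ t)%N (m ^ t.-1)%N #|_| => a b c; clear; lia.
Qed.

Lemma sum_level : \sum_(r < n) level R m K (bucket m K r) <= K%:R.
Proof.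
rewrite (partition_big (fun r : 'I_n => bucket m K r) predT) //=.
(* The last block has level 0, hence K and not K + 1. *)
apply: (@le_trans _ _ (\sum_(t < K.+1) (t < K)%:R)); last first.
  rewrite big_ord_recr /= ltnn addr0 (eq_bigr (fun=> 1)) => [|i _].
    by rewrite sumr_const card_ord.
  by rewrite ltn_ord.
apply: ler_sum => t _.
rewrite (eq_bigr (fun=> level R m K t)) => [|r /eqP -> //].
rewrite sumr_const -[leLHS]mulr_natr /level; case: ifP => tK; last by rewrite mul0r.
rewrite mulrC ler_pdivrMr ?exprn_gt0 ?ltr0n ?(ltnW m_gt1) // mul1r -natrX ler_nat.
by have := card_block_le tK; rewrite cardsE.
Qed.

Lemma social_welfare_level (c : R) (v : profile R n) (Y : {perm 'I_n}) :
    (forall i, v i (Y i) = c * level R m K (bucket m K (Y i))) ->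
    0 <= c ->
  social_welfare v Y <= c * K%:R.
Proof.
move=> vY c0; apply: le_trans (ler_wpM2l c0 sum_level).
rewrite mulr_sumr [leRHS](reindex_inj (@perm_inj _ Y)) /=.
by rewrite le_eqVlt /social_welfare (eq_bigr _ (fun i _ => vY i)) eqxx.
Qed.

End Blocks.

(** * Blocks left unqueried *)

Section Unqueried.
Variables (R : realType) (n m K : nat).

Definition unqueried (h : history R n) (i : 'I_n) : {set 'I_K.+1} :=
  ~: [set t in [seq bucket m K (q.1.2 : 'I_n) | q <- h & q.1.1 == i]].

Lemma unqueriedP (h : history R n) q t :
  t \in unqueried h q.1.1 -> q \in h -> bucket m K q.1.2 != t.
Proof.
rewrite !inE => + qh; apply: contraNneq => <-.
by apply: (map_f (fun q : 'I_n * 'I_n * R => bucket m K q.1.2)); rewrite mem_filter eqxx.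
Qed.

Lemma card_unqueried (h : history R n) i :
  (K.+1 - queries_to h i <= #|unqueried h i|)%N.
Proof.
rewrite cardsCs finset.setCK card_ord leq_sub2l // cardsE.
by apply: leq_trans (card_size _) _; rewrite size_map size_filter.
Qed.

End Unqueried.

(** With the identity ranking every item is its own position, so [bucket] applies to items
    directly. *)
Definition common_ranking (n : nat) : rankings n := fun=> 1%g.
Arguments common_ranking n : clear implicits.

(** * The adversary for unrestricted valuations *)

Section Unrestricted.
Variables (R : realType) (n m K : nat).
Hypotheses (K_gt0 : (0 < K)%N) (m_ge : (8 * K.+1 <= m)%N) (mKn : (m ^ K <= n)%N).

Let m_gt1 : (1 < m)%N. Proof. by lia. Qed.
Let m_gt0 : 0 < m%:R :> R. Proof. by rewrite ltr0n; lia. Qed.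
Let m_ge1 : 1 <= m%:R :> R. Proof. by rewrite ler1n; lia. Qed.

Definition canonical : profile R n := fun _ r => level R m K (bucket m K r).

Lemma canonical_ge0 : unrestricted canonical.
Proof. by move=> i r; apply: level_ge0. Qed.

Lemma canonical_consistent : consistent canonical (common_ranking n).
Proof.
move=> i r r' rr'; rewrite /canonical !perm1.
by apply: (level_homo _ _ m_gt1); apply: bucket_homo.
Qed.

Definition raised (t : 'I_K.+1) (P : 'I_n -> 'I_n -> bool) : profile R n :=
  fun i r => if (bucket m K r == t) && P i r then m%:R * m%:R ^- t
             else canonical i r.

Lemma raised_ge t P i r : canonical i r <= raised t P i r.
Proof.
rewrite /raised; case: ifP => // /andP[/eqP rt _].
rewrite /canonical rt (le_trans (level_le _ _ _ _)) //.
by rewrite ler_peMl // invr_ge0 exprn_ge0 // ltW.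
Qed.

Lemma raised_ge0 t P : unrestricted (raised t P).
Proof. by move=> i r; apply: le_trans (raised_ge _ _ _ _); apply: canonical_ge0. Qed.

(** Inside block [t] the closure of [P] under better positions keeps raised items on top; across
    blocks, [level_gap] bounds the raised value by every earlier level. *)
Lemma raised_consistent t (P : 'I_n -> 'I_n -> bool) :
    (forall (i r r' : 'I_n), (r <= r')%N -> P i r' -> P i r) ->
  consistent (raised t P) (common_ranking n).
Proof.
move=> Pmono i r r' rr'; rewrite !perm1 {1}/raised; case: ifP => [|_]; last first.
  apply: le_trans (raised_ge _ _ _ _).
  by have := canonical_consistent i rr'; rewrite !perm1.
move=> /andP[/eqP rt Pr']; have [rt'|rt'] := eqVneq (bucket m K r) t.
  by rewrite /raised rt' eqxx (Pmono _ _ _ rr' Pr').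
apply: le_trans (raised_ge _ _ _ _); apply: (level_gap R m_gt1) => //.
  by rewrite ltn_neqAle -{2}rt bucket_homo // andbT.
by rewrite -ltnS.
Qed.

Lemma unrestricted_lower_bound (A : algorithm R n) (d : R) :
    at_most_queries A K (@unrestricted R n) ->
    d <= m%:R / (8 * K%:R * K.+1%:R) ->
  distortion_at_least A K (@unrestricted R n) d.
Proof.
move=> AK dle; pose h := run A (common_ranking n) canonical (n * K).
pose Y := alg_output A (common_ranking n) h.
have [T TP] : exists T : 'I_n -> 'I_K.+1, forall i, T i \in unqueried m K h i.
  apply: (@fin_all_exists _ (fun=> 'I_K.+1)
    (fun i t => t \in unqueried m K h i)) => i; apply/card_gt0P.
  have [_ /(_ i) hK] := AK _ _ canonical_ge0 canonical_consistent.
  by apply: leq_trans (card_unqueried _ _ _ _); rewrite subn_gt0 ltnS.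
have n_gt0 : (0 < n)%N by apply: leq_trans mKn; rewrite expn_gt0; lia.
have [|t] := pigeonhole_fiber T; rewrite ?card_ord // => nc.
set Ft := [set i | T i == t] in nc.
have tK : (t <= K)%N by rewrite -ltnS.
have Ft_ge : (8 * m ^ K.-1 <= #|Ft|)%N.
  have : (8 * K.+1 * m ^ K.-1 <= K.+1 * #|Ft|)%N.
    rewrite (leq_trans _ nc) // (leq_trans _ mKn) //.
    by rewrite -[X in (_ <= m ^ X)%N](prednK K_gt0) expnS leq_mul2r m_ge orbT.
  by rewrite [(8 * _)%N]mulnC -mulnA leq_mul2l.
(* Before the last block, [S] holds the agents not served in block [t]; for the last block, those
   served in it. *)
pose S := [set i in Ft | (bucket m K (Y i) == t) == (t == ord_max)].
(* In the last block an agent of S is raised only at the positions before the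
   one it is matched to, so that there too the algorithm gains nothing. *)
pose v := raised t (fun i r => (i \in S) && ((t < K)%N || (r < Y i)%N)).
have v_ge0 : unrestricted v by apply: raised_ge0.
have vrk : consistent v (common_ranking n).
  apply: raised_consistent => i r r' rr' /andP[-> /orP[-> //|rY]].
  by rewrite (leq_ltn_trans rr' rY) orbT.
have runv : run A (common_ranking n) v (n * K) = h.
  apply: eq_run => q qh; rewrite /v /raised; case: ifP => // /and3P[/eqP qt].
  rewrite !inE => /andP[/eqP iT _]; have := TP q.1.1; rewrite iT => /unqueriedP.
  by move=> /(_ qh); rewrite qt eqxx.
(* A raised matched item would put an agent of [S] in block [t], forcing [t] to be last, and then
   require [Y i < Y i]. *)
have vY i : v i (Y i) = 1 * level R m K (bucket m K (Y i)).
  rewrite mul1r /v /raised; case: ifP => // /and3P[/eqP bY].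
  rewrite !inE bY eqxx ltnn orbF => /andP[_ /eqP/esym/eqP ->].
  by rewrite ltnn.
have alg : social_welfare v (alg_matching A K v (common_ranking n)) <= 1 * K%:R.
  rewrite /alg_matching runv.
  exact: (social_welfare_level m_gt1 mKn vY).
have Kr : 1 <= K%:R :> R by rewrite ler1n.
have Sr : K.+1%:R = K%:R + 1 :> R by rewrite -natr1.
(* Here [d'] times K is only a quarter of [w]; the constant 8 is dictated by the unit-sum case,
   where equality holds. *)
apply: (distortion_at_least_ratio (d' := m%:R / (8 * K%:R * K.+1%:R))
  (w := m%:R / (2 * K.+1%:R)) _ vrk v_ge0 alg) => //.
- by rewrite divr_gt0 // mulr_gt0.
- have mt0 : 0 < m%:R ^+ t :> R by rewrite exprn_gt0.
  have [tltK|Kt] := ltnP t K.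
  + have tmax : (t == ord_max) = false.
      by apply/negbTE; rewrite -val_eqE /= neq_ltn tltK.
    have B_le := card_block_le m_gt1 mKn tltK.
    have B_ge := card_block_ge K_gt0 m_gt1 mKn t.
    (* Agents of [Ft] outside [S] occupy items of block [t], whose size is at most m^(K-1), while
       [Ft] has at least 8 m^(K-1) agents. *)
    have BS : (#|block n m t| <= #|S|)%N.
      have FS : Ft \subset S :|: Y @^-1: block n m t.
        apply/fintype.subsetP => i; rewrite !inE tmax => ->.
        by case: (bucket m K (Y i) == t).
      have := leq_trans (subset_leq_card FS) (leq_card_setU _ _).
      rewrite (card_preimset _ (@perm_inj _ Y)).
      have : (m ^ t <= m ^ K.-1)%N by rewrite leq_pexp2l; lia.
      move: Ft_ge B_le; move: (m ^ t)%N (m ^ K.-1)%N #|block n m t| => a b c.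
      by lia.
    apply: (@le_trans _ _ (#|block n m t|%:R * (m%:R * m%:R ^- t))); last first.
      apply: (opt_welfare_ge v_ge0 BS (leqnn _)) => i j iS; rewrite inE => jB.
      by rewrite /v /raised jB iS tltK.
    have Bm : m%:R ^+ t <= 2 * #|block n m t|%:R :> R.
      by rewrite -natrX -natrM ler_nat.
    rewrite mulrA ler_pdivlMr // mulrAC ler_pdivrMr ?mulr_gt0 //.
    apply: le_trans (ler_wpM2l (ltW m_gt0) Bm) _.
    rewrite [leRHS](_ : _ = m%:R * (2 * #|block n m t|%:R) * K.+1%:R); last by ring.
    by rewrite ler_peMr ?ler1n // !mulr_ge0 // ltW.
  + have tmax : t = ord_max by apply/val_inj/eqP; rewrite /= eqn_leq tK.
    have tE : t = K :> nat by rewrite tmax.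
    have Sge : (#|Ft| <= 2 * #|S|)%N.
      have FS : Ft \subset S :|: Y @^-1: [set r : 'I_n | (r < m ^ K.-1)%N].
        apply/fintype.subsetP => i; rewrite !inE tmax eqxx => ->.
        rewrite -(@bucket_leq m K) ?prednK //=; case: eqVneq => //= bY.
        by move: bY (ltn_ord (bucket m K (Y i))); rewrite -val_eqE /=; lia.
      have := leq_trans (subset_leq_card FS) (leq_card_setU _ _).
      rewrite (card_preimset _ (@perm_inj _ Y)).
      rewrite card_ord_lt ?(expn_le m_gt1 mKn) ?leq_pred //.
      by move: Ft_ge; move: (m ^ K.-1)%N => b; lia.
    (* The shift is cyclic, but agents of [S] never hold position 0. Each moves up by one: to a
       raised item of block K, or to an earlier block, whose level is no smaller. *)
    pose Z := (Y * perm (@ord_pred_inj n))%g.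
    apply: (@le_trans _ _ (#|S|%:R * (m%:R * m%:R ^- t))); last first.
      apply: le_trans (social_welfare_le_opt _ Z).
      apply: (social_welfare_ge v_ge0) => i iS.
      have bY : bucket m K (Y i) = t.
        by move: iS; rewrite !inE tmax eqxx => /andP[_ /eqP/eqP ->].
      have Y0 : (0 < Y i)%N.
        rewrite lt0n; apply/eqP => Y0; move: bY; rewrite Y0 => /(congr1 val) /=.
        by rewrite bucketE up_log1 min0n tE; lia.
      have ZE : Z i = (Y i).-1 :> nat.
        rewrite permM permE /= -[in (_ + n)%N](prednK Y0) addSn /= modnDr modn_small //.
        by rewrite (leq_ltn_trans (leq_pred _)).
      have ZY : (Z i < Y i)%N by rewrite ZE prednK.
      rewrite /v /raised iS ZY orbT andbT; case: eqVneq => // Zt.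
      apply: (level_gap R m_gt1) => //.
      by rewrite ltn_neqAle -{2}bY bucket_homo ?andbT // ltnW.
    have mn : m%:R ^+ t <= K.+1%:R * (2 * #|S|%:R) :> R.
      rewrite -natrX -!natrM ler_nat tE (leq_trans mKn) // (leq_trans nc) //.
      by rewrite leq_mul2l Sge orbT.
    rewrite mulrA ler_pdivlMr // mulrAC ler_pdivrMr ?mulr_gt0 //.
    have := ler_wpM2l (ltW m_gt0) mn; move: (_ ^+ t) (#|_|%:R) => x b.
    by nra.
- rewrite mul1r [leLHS](_ : _ = m%:R / (2 * K.+1%:R) / 4).
    by rewrite ler_piMr // invf_le1 // ler1n.
  by rewrite Sr; field; rewrite !gt_eqF //; lra.
Qed.

End Unrestricted.

(** * The adversary for unit-sum valuations *)

Section UnitSum.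
Variables (R : realType) (n m k : nat).
Local Notation K := k.+1.
Hypotheses (m_ge : (8 * K.+1 <= m)%N) (mKn : (m ^ K <= n)%N).

Let m_gt1 : (1 < m)%N. Proof. by lia. Qed.
Let m_gt0 : 0 < m%:R :> R. Proof. by rewrite ltr0n; lia. Qed.
Let m_ge8 : 8 <= m%:R :> R. Proof. by rewrite (ler_nat R 8); lia. Qed.

(** The factor 4 / m is small enough to leave half of the unit mass spare, and large enough for
    earlier blocks to dominate a filled one. *)
Definition scaled : profile R n := fun _ r => 4 / m%:R * level R m K (bucket m K r).

Definition spare : R := 1 - 4 / m%:R * \sum_(r < n) level R m K (bucket m K r).

Definition filled (T : 'I_n -> 'I_K.+1) : profile R n := fun i r =>
  scaled i r + (if bucket m K r == T i then spare / #|block n m (T i)|%:R else 0).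

Lemma spare_le1 : spare <= 1.
Proof.
rewrite lerBlDr lerDl; apply: mulr_ge0; first by rewrite divr_ge0.
by apply: sumr_ge0 => r _; exact: level_ge0.
Qed.

Lemma spare_ge : 2^-1 <= spare.
Proof.
have Km : 8 * K%:R <= m%:R :> R by rewrite -natrM ler_nat; lia.
have := sum_level R m_gt1 mKn; rewrite /spare; move: (\sum_(_ < _) _) => x xK.
suff : 4 / m%:R * x <= 2^-1 by lra.
by rewrite mulrAC ler_pdivrMr //; lra.
Qed.

Lemma card_block_gt0 (t : 'I_K.+1) : 0 < #|block n m t|%:R :> R.
Proof.
rewrite ltr0n; have := card_block_ge (ltn0Sn _) m_gt1 mKn t.
have : (0 < m ^ t)%N by rewrite expn_gt0 ltnW.
by move: (m ^ t)%N #|_| => a b; lia.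
Qed.

Let fill_ge0 (t : 'I_K.+1) : 0 <= spare / #|block n m t|%:R.
Proof. by have := spare_ge => s; rewrite divr_ge0 //; lra. Qed.

Lemma scaled_ge0 : unrestricted scaled.
Proof. by move=> i r; rewrite mulr_ge0 ?divr_ge0 ?level_ge0. Qed.

Lemma filled_ge T i r : scaled i r <= filled T i r.
Proof. by rewrite lerDl; case: ifP. Qed.

Lemma filled_unit_sum T : unit_sum (filled T).
Proof.
split=> [i r|i]; first by apply: le_trans (filled_ge _ _ _); apply: scaled_ge0.
have fill : \sum_(r < n)
    (if bucket m K r == T i then spare / #|block n m (T i)|%:R else 0) = spare.
  rewrite -big_mkcond (eq_bigl (fun r => r \in block n m (T i))) => [|r].
    by rewrite sumr_const -[LHS]mulr_natr divfK ?gt_eqF ?card_block_gt0.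
  by rewrite inE.
by rewrite big_split /= -mulr_sumr fill addrC subrK.
Qed.

(** By [card_block_ge] the filling adds at most 2 m^-t per item of block t, so a filled item is
    worth at most (4/m + 2) m^-t. Earlier blocks are worth at least 4 m^-t. *)
Lemma filled_consistent T : consistent (filled T) (common_ranking n).
Proof.
move=> i r r' rr'; rewrite !perm1 {1}/filled; set t := T i.
case: eqVneq => [r't|_]; last first.
  rewrite addr0; apply: le_trans (filled_ge _ _ _).
  rewrite /scaled ler_wpM2l ?divr_ge0 //.
  by apply: level_homo => //; apply: bucket_homo.
have [rt|rt] := eqVneq (bucket m K r) t.
  by rewrite /filled /scaled r't rt eqxx.
apply: le_trans (filled_ge _ _ _).
have rltt : (bucket m K r < t)%N by rewrite ltn_neqAle rt -r't bucket_homo.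
have tK : (t <= K)%N by rewrite -ltnS.
have gap := level_gap R m_gt1 rltt tK.
have lt := level_le R m K t.
have mt0 : 0 < m%:R ^+ t :> R by rewrite exprn_gt0.
have fill_le : spare / #|block n m t|%:R <= 2 * m%:R ^- t.
  rewrite ler_pdivrMr ?card_block_gt0 // mulrAC ler_pdivlMr //.
  have Bm : m%:R ^+ t <= 2 * #|block n m t|%:R :> R.
    by rewrite -natrX -natrM ler_nat; exact: card_block_ge.
  by apply: le_trans Bm; rewrite ler_piMl ?spare_le1 // ltW.
rewrite /scaled r't.
have im0 : 0 <= 4 / m%:R :> R by rewrite divr_ge0.
apply: le_trans (ler_wpM2l im0 gap); rewrite mulrA divfK ?gt_eqF //.
apply: le_trans (lerD (ler_wpM2l im0 lt) fill_le) _.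
rewrite -mulrDl ler_wpM2r ?invr_ge0 ?exprn_ge0 //.
suff : 4 / m%:R <= 2 :> R by lra.
by rewrite ler_pdivrMr //; have := m_ge8; lra.
Qed.

Lemma run_filled (A : algorithm R n) T f :
    (forall i, T i \in unqueried m K (run A (common_ranking n) scaled f) i) ->
  run A (common_ranking n) (filled T) f = run A (common_ranking n) scaled f.
Proof.
move=> TP; apply: eq_run => q qh; rewrite /filled ifN ?addr0 //.
exact: unqueriedP (TP _) qh.
Qed.

(* The scaled canonical profile is not unit-sum, but as long as an agent has
   been asked at most k + 1 queries some block is left to fill. *)
Lemma scaled_queries (A : algorithm R n) f i :
    at_most_queries A k (@unit_sum R n) -> (f <= n * k)%N ->
  (queries_to (run A (common_ranking n) scaled f) i <= k)%N.
Proof.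
move=> Ak; elim: f i => [//|f IHf] i fnk.
have [T TP] : exists T : 'I_n -> 'I_K.+1,
    forall i, T i \in unqueried m K (run A (common_ranking n) scaled f.+1) i.
  apply: (@fin_all_exists _ (fun=> 'I_K.+1)
    (fun i t => t \in unqueried m K (run A (common_ranking n) scaled f.+1) i)) => j.
  apply/card_gt0P; apply: leq_trans (card_unqueried _ _ _ _).
  rewrite subn_gt0 ltnS (leq_trans (queries_to_runS _ _ _ _ _)) //.
  by rewrite ltnS IHf // ltnW.
(* The run is now that of a unit-sum profile, so the budget [k] holds for its first f + 1 steps. *)
rewrite -(run_filled TP).
have [_ /(_ i)] := Ak _ _ (filled_unit_sum T) (filled_consistent T).
exact: leq_trans (queries_to_run_le _ _ _ _ fnk).
Qed.

Lemma unit_sum_lower_bound (A : algorithm R n) (d : R) :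
    at_most_queries A k (@unit_sum R n) ->
    d <= m%:R / (8 * K%:R * K.+1%:R) ->
  distortion_at_least A k (@unit_sum R n) d.
Proof.
move=> Ak dle; pose h := run A (common_ranking n) scaled (n * k).
pose Y := alg_output A (common_ranking n) h.
have [T TP] : exists T : 'I_n -> 'I_K.+1,
    forall i, T i \in unqueried m K h i :\ bucket m K (Y i).
  apply: (@fin_all_exists _ (fun=> 'I_K.+1)
    (fun i t => t \in unqueried m K h i :\ bucket m K (Y i))) => i.
  apply/card_gt0P; have := card_unqueried m K h i.
  rewrite (cardsD1 (bucket m K (Y i))); have := scaled_queries i Ak (leqnn _).
  rewrite -/h; have := leq_b1 (bucket m K (Y i) \in unqueried m K h i).
  move: (queries_to h i) (nat_of_bool _) #|_ :\ _| => q b c; lia.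
have runv : run A (common_ranking n) (filled T) (n * k) = h.
  by apply: run_filled => i; have := TP i; rewrite in_setD1 => /andP[].
have n_gt0 : (0 < n)%N by apply: leq_trans mKn; rewrite expn_gt0 ltnW.
have [|t] := pigeonhole_fiber T; rewrite ?card_ord // => nc.
set S := [set i | T i == t] in nc.
have vY i : filled T i (Y i) = 4 / m%:R * level R m K (bucket m K (Y i)).
  have := TP i; rewrite in_setD1 eq_sym => /andP[Yt _].
  by rewrite /filled ifN ?addr0.
have im0 : 0 <= 4 / m%:R :> R by rewrite divr_ge0.
have alg : social_welfare (filled T) (alg_matching A k (filled T) (common_ranking n))
    <= 4 / m%:R * K%:R.
  by rewrite /alg_matching runv; exact: (social_welfare_level m_gt1 mKn vY).
have [v_ge0 _] := filled_unit_sum T.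
apply: (distortion_at_least_ratio (d' := m%:R / (8 * K%:R * K.+1%:R))
  (w := (2 * K.+1%:R)^-1) (filled_unit_sum T) (filled_consistent T) v_ge0 alg) => //.
(* Either set may be the smaller. As [S] has at least n / (K + 1) agents, [c] is at least a fraction
   1 / (K + 1) of the block in both cases, and so collects that fraction of [spare]. *)
- pose c := minn #|S| #|block n m t|.
  apply: (@le_trans _ _ (c%:R * (spare / #|block n m t|%:R))); last first.
    apply: (opt_welfare_ge v_ge0 (geq_minl _ _) (geq_minr _ _)) => i j.
    rewrite !inE => /eqP Ti jt.
    by rewrite /filled Ti jt lerDr scaled_ge0.
  have Bc : #|block n m t|%:R <= K.+1%:R * c%:R :> R.
    rewrite -natrM ler_nat /c.
    have [_|_] := leqP #|S| #|block n m t|; last by rewrite leq_pmull.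
    by apply: leq_trans nc; rewrite -[leqRHS]card_ord max_card.
  rewrite mulrA ler_pdivlMr ?card_block_gt0 // mulrC ler_pdivrMr //.
  apply: le_trans Bc _.
  have := spare_ge; move: spare => s s2.
  rewrite [leRHS](_ : _ = (K.+1%:R * c%:R) * (2 * s)); last by ring.
  by rewrite ler_peMr //; lra.
- rewrite [leLHS](_ : _ = (2 * K.+1%:R)^-1) //; field.
  by rewrite !gt_eqF.
Qed.

End UnitSum.

(** * Choice of the scale m *)

Lemma root_scale (R : realType) (K n : nat) :
    (0 < K)%N -> ((8 * K.+1) ^ K <= n)%N ->
  exists m : nat, [/\ (8 * K.+1 <= m)%N, (m ^ K <= n)%N
    & (16 * K%:R * K.+1%:R)^-1 * n%:R `^ (K%:R)^-1
        <= m%:R / (8 * K%:R * K.+1%:R) :> R].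
Proof.
move=> K0 Kn; set x := n%:R `^ _; have x0 : 0 <= x by exact: powR_ge0.
have K0r : 0 < K%:R :> R by rewrite ltr0n.
have xK : x ^+ K = n%:R.
  by rewrite -powR_mulrn // -powRrM mulVf ?gt_eqF // powRr1.
have ge8 : (8 * K.+1)%:R <= x.
  by rewrite -(@ler_pXn2r _ K) ?nnegrE // xK -natrX ler_nat.
have /andP[mx xm] := truncn_itv x0; set m := Num.truncn x in mx xm.
have m1 : 1 <= m%:R :> R.
  by rewrite ler1n truncn_gt0 (le_trans _ ge8) // ler1n muln_gt0.
exists m; split; first by rewrite truncn_ge_nat.
  by rewrite -(ler_nat R) natrX -xK lerXn2r ?nnegrE.
(* Truncation costs a factor 2, since x < m + 1 <= 2 m; this turns 8 into 16. *)
rewrite mulrC ler_pdivrMr ?mulr_gt0 // mulrAC ler_pdivlMr ?mulr_gt0 //.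
rewrite [leRHS](_ : _ = 2 * m%:R * (8 * K%:R * K.+1%:R)); last by ring.
rewrite ler_pM2r ?mulr_gt0 //; move: xm; rewrite -natr1; lra.
Qed.

Lemma ln_le_sub1 (R : realType) (x : R) : 0 < x -> ln x <= x - 1.
Proof.
by move=> x0; have := @le_ln1Dx R (x - 1); rewrite [1 + _]addrC subrK; apply; lra.
Qed.

Lemma log_scale (R : realType) (kq : nat -> nat) (M : R) :
    (forall eps : R, 0 < eps -> exists N : nat, forall n : nat, (N <= n)%N ->
       (kq n)%:R <= eps * (ln (n%:R : R) / ln (ln (n%:R : R)))) ->
    0 < M ->
  exists N : nat, forall n : nat, (N <= n)%N ->
    exists m : nat, [/\ (8 * (kq n).+2 <= m)%N, (m ^ (kq n).+1 <= n)%N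
      & M * ln (ln (n%:R : R)) <= m%:R / (8 * (kq n).+1%:R * (kq n).+2%:R)].
Proof.
move=> kqo M0; have [N1 kN1] := kqo 8^-1 ltac:(by rewrite invr_gt0).
(* With L = ln n and l = ln L, the term 256 gives l <= L / 8 through the square root of L, [16 * M]
   gives M <= L / 16, and [expR 1] gives l >= 1. *)
pose C := 256 + 16 * M + expR 1.
exists (maxn N1 (Num.truncn (expR C)).+1) => n; rewrite geq_max => /andP[N1n Cn].
have e0 : 0 < expR 1 :> R := expR_gt0 _.
have nC : expR C < n%:R.
  by apply: lt_le_trans (truncnS_gt _) _; rewrite ler_nat.
have n0 : 0 < n%:R :> R by apply: lt_trans nC; exact: expR_gt0.
have := kN1 _ N1n; set L := ln n%:R; set l := ln L; set k := kq n => kle.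
have LC : C <= L by rewrite -(expRK C) ler_ln ?posrE ?expR_gt0 // ltW.
have L256 : 256 <= L by rewrite (le_trans _ LC) // /C; lra.
have LM : 16 * M <= L by rewrite (le_trans _ LC) // /C; lra.
have L0 : 0 < L by lra.
have l1 : 1 <= l.
  rewrite -(expRK 1) ler_ln ?posrE ?expR_gt0 // (le_trans _ LC) // /C; lra.
have lL : l <= L by rewrite (le_trans (ln_le_sub1 L0)) //; lra.
have l8 : l <= L / 8.
  have s0 : 0 <= Num.sqrt L := sqrtr_ge0 _.
  have sL : Num.sqrt L ^+ 2 = L by rewrite sqr_sqrtr // ltW.
  have s16 : 16 <= Num.sqrt L.
    by rewrite -(@ler_pXn2r _ 2) ?nnegrE // sL; lra.
  have lns := ln_le_sub1 (lt_le_trans (ltr0n R 16) s16).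
  rewrite /l -sL lnXn ?(lt_le_trans _ s16) // -mulr_natr.
  by move: (Num.sqrt L) (ln (Num.sqrt L)) s16 lns => s ls; nra.
have kl : k%:R * l <= L / 8.
  by move: kle; rewrite mulrA ler_pdivlMr; lra.
have Kl : k.+1%:R * l <= L / 4 by rewrite -natr1 mulrDl mul1r; lra.
have K1 : 1 <= k.+1%:R :> R by rewrite ler1n.
have KL : k.+1%:R <= L / 4 by rewrite (le_trans _ Kl) // ler_peMr.
have KL2 : k.+2%:R <= L / 2 by rewrite -natr1; lra.
have L4 : 256 * L <= L ^+ 4.
  rewrite exprS mulrC ler_pM2l //.
  by rewrite (le_trans L256) // ler_eXnr //; lra.
have L40 : 0 <= L ^+ 4 by rewrite exprn_ge0 // ltW.
exists (Num.truncn (L ^+ 4)); split.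
- by rewrite truncn_ge_nat // natrM; lra.
- rewrite -(ler_nat R) natrX.
  apply: (@le_trans _ _ ((L ^+ 4) ^+ k.+1)).
    by rewrite lerXn2r ?nnegrE // truncn_le.
  rewrite -(@lnK _ L) ?posrE // -/l -(@lnK _ n%:R) ?posrE // -/L.
  rewrite -!expRM_natl ler_expR; lra.
- rewrite ler_pdivlMr ?mulr_gt0 //.
  have := truncnS_gt (L ^+ 4); rewrite -natr1 => Lm.
  suff : M * l * (8 * k.+1%:R * k.+2%:R) <= L ^+ 4 / 2 by lra.
  (* This explains the exponent 4: each of M, l, k + 1 and k + 2 is at most a multiple of L. *)
  apply: (@le_trans _ _ (L / 16 * L * (8 * (L / 4) * (L / 2)))); last by lra.
  have l0 : 0 <= l by lra.
  have M16 : M <= L / 16 by lra.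
  have M0' := ltW M0.
  by rewrite !ler_pM ?mulr_ge0.
Qed.

(** Yields the unrestricted half of (ii) from the unit-sum bound. In (i) this would only give the
    exponent 1/(k+1). *)
Lemma unit_sum_unrestricted (R : realType) n (A : algorithm R n) k (d : R) :
  distortion_at_least A k (@unit_sum R n) d ->
  distortion_at_least A k (@unrestricted R n) d.
Proof. by move=> [v [rk [[v_ge0 _] P]]]; exists v, rk. Qed.

Unset Implicit Arguments.

Theorem mainTheorem8 (R : realType) :
  (* (i) constant number k >= 1 of queries per agent *)
  (forall k : nat, (1 <= k)%N ->
     (exists c : R, 0 < c /\ exists N : nat, forall n : nat, (N <= n)%N ->
        forall A : algorithm R n, at_most_queries A k (@unrestricted R n) ->
          distortion_at_least A k (@unrestricted R n)
            (c * (n%:R `^ (k%:R)^-1))) /\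
     (exists c : R, 0 < c /\ exists N : nat, forall n : nat, (N <= n)%N ->
        forall A : algorithm R n, at_most_queries A k (@unit_sum R n) ->
          distortion_at_least A k (@unit_sum R n)
            (c * (n%:R `^ (k.+1%:R)^-1)))) /\
  (* (ii) k(n) = o(log n / log log n) queries per agent *)
  (forall kq : nat -> nat,
     (forall eps : R, 0 < eps -> exists N : nat, forall n : nat, (N <= n)%N ->
        (kq n)%:R <= eps * (ln (n%:R : R) / ln (ln (n%:R : R)))) ->
     (forall M : R, 0 < M -> exists N : nat, forall n : nat, (N <= n)%N ->
        forall A : algorithm R n, at_most_queries A (kq n) (@unrestricted R n) ->
          distortion_at_least A (kq n) (@unrestricted R n) (M * ln (ln (n%:R : R)))) /\
     (forall M : R, 0 < M -> exists N : nat, forall n : nat, (N <= n)%N ->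
        forall A : algorithm R n, at_most_queries A (kq n) (@unit_sum R n) ->
          distortion_at_least A (kq n) (@unit_sum R n) (M * ln (ln (n%:R : R))))).
Proof.
split=> [k k_gt0|kq kqo].
  split.
    exists (16 * k%:R * k.+1%:R)^-1; split.
      by rewrite invr_gt0 !mulr_gt0 ?ltr0n.
    exists ((8 * k.+1) ^ k)%N => n nN A Ak.
    have [m [m_ge mn dm]] := root_scale R k_gt0 nN.
    exact: unrestricted_lower_bound Ak dm.
  exists (16 * k.+1%:R * k.+2%:R)^-1; split.
    by rewrite invr_gt0 !mulr_gt0 ?ltr0n.
  exists ((8 * k.+2) ^ k.+1)%N => n nN A Ak.
  have [m [m_ge mn dm]] := root_scale R (ltn0Sn k) nN.
  exact: unit_sum_lower_bound Ak dm.
split=> M M_gt0; have [N scale] := log_scale kqo M_gt0; exists N => n nN A Ak.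
  have [m [m_ge mn dm]] := scale n nN.
  apply: unit_sum_unrestricted; apply: unit_sum_lower_bound dm => //.
  by move=> v rk [v_ge0 _]; exact: Ak.
have [m [m_ge mn dm]] := scale n nN.
exact: unit_sum_lower_bound Ak dm.
Qed.
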